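(* Let $M=p_1^{n_1}\cdots p_d^{n_d}$, where $p_1<\dots<p_d$ are distinct primes and $n_1,\dots,n_d\in\mathbb{N}$ (so $n_i\ge 1$). Assume that $p_j>2^{j-2}$ for all $j\in\{6,\dots,d\}$. Then for every nonempty set $A\subset\mathbb{Z}_M$ such that $\Phi_M(X)$ divides $A(X)$, there exists $i\in\{1,\dots,d\}$ such that $M/p_i\in\mathrm{Div}(A)$. Consequently, for any tiling $A\oplus B=\mathbb{Z}_M$ there exists $i\in\{1,\dots,d\}$ such that $M/p_i\in\mathrm{Div}(A)\cup\mathrm{Div}(B)$.
   Context: Elements of $\mathbb{Z}_M$ are represented by integers in $\{0,1,\dots,M-1\}$. For a set $A\subset\mathbb{Z}_M$, its mask polynomial is $A(X)=\sum_{a\in A}X^a$; $\Phi_M(X)$ denotes the $M$-th cyclotomic polynomial (divisibility of $A(X)$ by $\Phi_M$ does not depend on the choice of representatives since $\Phi_M\mid X^M-1$). For $m,n\in\mathbb{Z}$, $(m,n)$ denotes their greatest common divisor. The divisor set of $A$ is $\mathrm{Div}(A)=\{(a-a',M): a,a'\in A\}$. For $A,B\subset\mathbb{Z}_M$, we write $A\oplus B=\mathbb{Z}_M$ (a tiling) if every element of $\mathbb{Z}_M$ can be written uniquely as $a+b \bmod M$ with $a\in A$, $b\in B$. *)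

(* Defs.v *)
From mathcomp Require Import all_boot all_order all_algebra all_field.

Set Implicit Arguments.
Unset Strict Implicit.
Unset Printing Implicit Defensive.

Import GRing.Theory.
Local Open Scope ring_scope.

(* 'Z_M is the cyclic group of order M only for M > 1; its elements are
   ordinals, whose coercion to nat gives the representative in {0, ..., M-1}. *)

Definition mask_poly (M : nat) (A : {set 'Z_M}) : {poly int} :=
  \sum_(a in A) 'X^(nat_of_ord a).

(* `|a - a'| is the distance between the natural representatives (the
   subtraction is that of int), so that gcdn `|a - a'| M is the gcd of the
   integers a - a' and M; in particular it is M when a = a'. *)
Definition Div (M : nat) (A : {set 'Z_M}) : pred nat :=
  [pred k | [exists a in A, exists a' in A,
     k == gcdn `|(nat_of_ord a)%:Z - (nat_of_ord a')%:Z|%N M]].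

Definition tiling (M : nat) (A B : {set 'Z_M}) : Prop :=
  forall x : 'Z_M,
    exists! ab : 'Z_M * 'Z_M,
      [/\ ab.1 \in A, ab.2 \in B & ab.1 + ab.2 = x].

Arguments mask_poly M A : clear implicits.
Arguments Div M A : clear implicits.
Arguments tiling M A B : clear implicits.

(* Main.v *)
(* If no [M/p_i] lies in [Div A], then [A] has at most one point on each coset
   of the subgroup of order [p_i].  Fix [a] in [A].  Because [2^(j-2) < p_j]
   for all [j] (1-based; for [j <= 5] by monotonicity and parity), one can choose
   greedily nonzero multiples [y_j] of [M/p_j] such that no vertex
   [a + \sum_(j in S) y_j] with [#|S|] odd lies in [A].  The alternating sum of
   the indicator of [A] over this cuboid is then positive; but it is zero when
   [Phi_M] divides [A(X)], since the Fourier transform of the signed cuboid is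
   supported on the primitive [M]-th roots of unity.  For a tiling,
   [A(z) B(z) = 0] at a primitive root [z], and irreducibility of [Phi_M]
   carries the vanishing of one factor over to all primitive roots. *)

Require Import Defs.
From mathcomp Require Import all_boot all_order all_algebra all_field.
From mathcomp Require Import zify.

Import GRing.Theory Num.Theory.
Local Open Scope ring_scope.

Set Implicit Arguments.
Unset Strict Implicit.

(** * Greedy choice of the cuboid *)

(** Deleting a fixed [x] of [D] is injective on even subsets, since parity tells whether [x] was
    present. For empty [D] both sides are 1. *)
Lemma card_even_subsets (T : finType) (D : {set T}) :
  (#|[set S in powerset D | ~~ odd #|S|]| <= 2 ^ #|D|.-1)%N.
Proof.
have [->|/set0Pn[x xD]] := eqVneq D set0.
  rewrite cards0 expn0 -(cards1 (@set0 T)); apply/subset_leq_card/subsetP => S.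
  by rewrite powerset0 !inE => /andP[].
have -> : #|D|.-1 = #|D :\ x| by rewrite (cardsD1 x D) xD.
rewrite -card_powerset -(card_in_imset (f := fun S => S :\ x)).
  apply/subset_leq_card/subsetP => _ /imsetP[S + ->].
  by rewrite !inE => /andP[SD _]; rewrite setSD.
move=> S S'; rewrite !inE => /andP[_ eS] /andP[_ eS'] eqSS'.
have xSS' : (x \in S) = (x \in S').
  move: eS eS'; rewrite (cardsD1 x S) (cardsD1 x S') eqSS'.
  by case: (x \in S) (x \in S') => [] [] //=; case: odd.
by apply/setP => i; have /setP/(_ i) := eqSS'; rewrite !inE; case: eqVneq => [->|].
Qed.

(* The [y i] are chosen greedily: each nonempty even set of smaller indices
   rules out at most one candidate for [y k], and there are fewer than
   [2 ^ k.-1] such sets. *)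
Lemma avoiding_cuboid (V : zmodType) (d : nat) (Y : 'I_d -> seq V)
    (P : pred V) (a : V) :
  (forall i, uniq (Y i)) ->
  (forall i : 'I_d, (2 ^ i.-1 <= size (Y i))%N) ->
  (forall i u, u \in Y i -> ~~ P (a + u)) ->
  (forall i x u v, u \in Y i -> v \in Y i -> P (x + u) -> P (x + v) -> u = v) ->
  exists2 y : 'I_d -> V, forall i, y i \in Y i &
    forall S : {set 'I_d}, odd #|S| -> ~~ P (a + \sum_(i in S) y i).
Proof.
move=> uY szY aY lineY.
pose D k := [set i : 'I_d | (i < k)%N].
suff: forall k, (k <= d)%N -> exists y : 'I_d -> V,
    (forall i : 'I_d, (i < k)%N -> y i \in Y i) /\
    forall S : {set 'I_d}, S \subset D k -> odd #|S| ->
      ~~ P (a + \sum_(i in S) y i).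
  case/(_ d (leqnn d)) => y [yY yP]; exists y => [i|S oS]; first exact: yY.
  by apply: yP => //; apply/subsetP => i _; rewrite inE.
elim=> [_|k IHk ltkd].
  exists (fun=> 0); split=> // S /subsetP S0.
  suff -> : S = set0 by rewrite cards0.
  by apply/setP => i; rewrite inE; apply/negP => /S0; rewrite inE.
have [y [yY yP]] := IHk (ltnW ltkd).
pose i0 := Ordinal ltkd.
(* An odd set with largest index [k] is an even set [S] below [k] together with [i0]. Empty [S] is
   left to [aY]; dropping it makes the bound [cE] strict. *)
pose E := [set S in powerset (D k) | ~~ odd #|S|] :\ set0.
pose bad u (S : {set 'I_d}) := P (a + \sum_(i in S) y i + u).
have cE : (#|E| < size (Y i0))%N.
  apply: leq_trans (szY i0); have := card_even_subsets (D k).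
  have -> : #|D k| = k.
    by rewrite -sum1dep_card (big_ord_narrow (ltnW ltkd)) sum1_card card_ord.
  by rewrite (cardsD1 set0) !inE cards0 sub0set.
have [u uY0 ugood] : exists2 u, u \in Y i0 & forall S, S \in E -> ~~ bad u S.
  have [/hasP[u uY0 /forall_inP ugood]|/hasPn nogood] :=
    boolP (has (fun u => [forall S in E, ~~ bad u S]) (Y i0)).
    by exists u.
  (* Pigeonhole: if all candidates are bad, [g] picks a set of [E] ruling each one out, so the
     default is never taken, and [lineY] makes [g] injective. *)
  pose g u := odflt set0 [pick S in E | bad u S].
  have gP u : u \in Y i0 -> g u \in E /\ bad u (g u).
    move=> /nogood; rewrite negb_forall_in => /exists_inP[S SE /negPn bS].
    by rewrite /g; case: pickP => [S' /andP[]|/(_ S)] //; rewrite SE bS.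
  have gI : {in Y i0 &, injective g}.
    move=> u v uY0 vY0 eg; have [_ bu] := gP u uY0; have [_ bv] := gP v vY0.
    by rewrite -eg in bv; exact: lineY uY0 vY0 bu bv.
  have: (size (map g (Y i0)) <= size (enum E))%N.
    apply: uniq_leq_size; first by rewrite map_inj_in_uniq.
    by move=> _ /mapP[u uY0 ->]; rewrite mem_enum; case: (gP u uY0).
  by rewrite size_map -cardE leqNgt cE.
pose y' i := if i == i0 then u else y i.
have sumy' (S : {set 'I_d}) : S \subset D k -> \sum_(i in S) y' i = \sum_(i in S) y i.
  move=> /subsetP SD; apply: eq_bigr => i /SD; rewrite inE /y'.
  by case: eqVneq => [->|//]; rewrite ltnn.
exists y'; split=> [i|S SD oS].
  rewrite ltnS leq_eqVlt /y'; case: (eqVneq i i0) => [-> _|ne /predU1P[eik|]] //.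
    by case/eqP: ne; apply: val_inj.
  exact: yY.
have SD' : S :\ i0 \subset D k.
  apply/subsetP => i; rewrite 2!inE => /andP[ne iS]; have := subsetP SD _ iS.
  by rewrite !inE ltnS leq_eqVlt => /predU1P[eik|//]; case/eqP: ne; apply: val_inj.
have [i0S|i0S] := boolP (i0 \in S); last first.
  have eS : S :\ i0 = S.
    by apply/setP => i; rewrite !inE; case: eqVneq => // ->; rewrite (negPf i0S).
  by rewrite eS in SD'; rewrite sumy' // yP.
rewrite (big_setD1 i0) //= sumy' // {1}/y' eqxx addrCA addrC.
have [->|ne] := eqVneq (S :\ i0) set0; first by rewrite big_set0 addr0 (aY i0).
apply: ugood; rewrite !inE ne SD' /=.
by move: oS; rewrite (cardsD1 i0) i0S.
Qed.

(** * Characters and Fourier inversion on ['Z_M] *)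

Lemma val_ZpD (M : nat) (x y : 'Z_M) :
  (1 < M)%N -> nat_of_ord (x + y) = ((x + y)%N %% M)%N.
Proof. by move=> M1; congr (_ %% _)%N; apply: Zp_cast. Qed.

Lemma exprZpD (M : nat) (z : algC) (x y : 'Z_M) :
  (1 < M)%N -> M.-primitive_root z -> z ^+ (x + y)%R = z ^+ x * z ^+ y.
Proof.
by move=> M1 zP; rewrite val_ZpD // -exprD prim_expr_mod.
Qed.

Lemma exprZp_mulrn (M : nat) (z : algC) (x : 'Z_M) (t : nat) :
  (1 < M)%N -> M.-primitive_root z -> z ^+ (x *+ t)%R = (z ^+ x) ^+ t.
Proof.
move=> M1 zP; elim: t => [|t IHt]; first by rewrite mulr0n.
by rewrite mulrS exprZpD // IHt exprS.
Qed.

Lemma sum_exprZp (M : nat) (z : algC) (x : 'Z_M) :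
  (1 < M)%N -> M.-primitive_root z ->
  \sum_(t < M) (z ^+ x) ^+ t = if x == 0 then M%:R else 0.
Proof.
move=> M1 zP; case: eqVneq => [->|xn0].
  under eq_bigr do rewrite expr0 expr1n.
  by rewrite sumr_const card_ord.
have zx1 : z ^+ x != 1.
  rewrite -(prim_order_dvd zP) gtnNdvd //.
    by rewrite lt0n; apply: contra xn0 => /eqP x0; apply/eqP/val_inj.
  by case: x {xn0} => x /=; rewrite Zp_cast.
have: (z ^+ x - 1) * \sum_(t < M) (z ^+ x) ^+ t = 0.
  by rewrite -subrX1 exprAC (prim_expr_order zP) expr1n subrr.
by move/eqP; rewrite mulf_eq0 subr_eq0 (negPf zx1) => /eqP.
Qed.

(* Fourier inversion: the signed cuboid is [\prod_i (1 - X^(- y i))], and the last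
   hypothesis makes one of its factors vanish at every nonprimitive root of unity. *)
Lemma cuboid_sum_eq0 (M d : nat) (z : algC) (A : {set 'Z_M})
    (y : 'I_d -> 'Z_M) (a : 'Z_M) :
  (1 < M)%N -> M.-primitive_root z ->
  (forall t, coprime t M -> \sum_(b in A) z ^+ (t * b) = 0) ->
  (forall t, ~~ coprime t M -> exists i, y i *+ t = 0) ->
  \sum_(S : {set 'I_d})
     (-1) ^+ #|S| * (a + \sum_(i in S) y i \in A)%:R = 0 :> algC.
Proof.
move=> M1 zP zA yt.
pose chi (x : 'Z_M) := z ^+ x.
have chiD x1 x2 : chi (x1 + x2) = chi x1 * chi x2 by apply: exprZpD.
have sum_chi x : \sum_(t < M) chi x ^+ t = if x == 0 then M%:R else 0.
  exact: sum_exprZp.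
have Mn0 : M%:R != 0 :> algC by rewrite pnatr_eq0 -lt0n ltnW.
apply: (mulfI Mn0); rewrite mulr0.
transitivity (\sum_(t < M) chi (- a) ^+ t * (\sum_(b in A) chi b ^+ t)
    * \prod_i (1 - chi (- y i) ^+ t)); last first.
  apply: big1 => t _; have [/zA zAt|/yt[i yi]] := boolP (coprime t M).
    under [\sum_(b in A) _]eq_bigr do rewrite -exprM mulnC.
    by rewrite zAt mulr0 mul0r.
  rewrite (bigD1 i) //= /chi -[(z ^+ (- y i)%R) ^+ t]exprZp_mulrn //.
  by rewrite mulNrn yi oppr0 expr0 subrr mul0r mulr0.
(* Expanding the product over subsets [S] produces the signs and the translates by
   [\sum_(i in S) y i]. *)
transitivity (\sum_(t < M) \sum_(S : {set 'I_d}) (-1) ^+ #|S| *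
    \sum_(b in A) chi (b - (a + \sum_(i in S) y i)) ^+ t); last first.
  apply: eq_bigr => t _; under [X in _ * X]eq_bigr do rewrite addrC.
  rewrite bigA_distr [RHS]mulr_sumr; apply: eq_bigr => S _.
  rewrite -big_mkcond prodrN mulrCA -mulrA; congr (_ * _).
  rewrite prodrXl -(big_morph chi chiD (erefl : chi 0 = 1)).
  rewrite mulrCA -exprMn -chiD mulr_suml; apply: eq_bigr => b _.
  by rewrite -exprMn -chiD sumrN opprD.
(* Summing over [t] first, orthogonality keeps only [b = a + \sum_(i in S) y i]. *)
rewrite exchange_big mulr_sumr; apply: eq_bigr => S _.
rewrite -mulr_sumr exchange_big mulrCA /=; congr (_ * _).
under [RHS]eq_bigr do rewrite sum_chi subr_eq0.
rewrite -big_mkcondr; set x := a + _; have [xA|xA] := boolP (x \in A).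
  by rewrite mulr1 (big_pred1 x) // => b /=; case: eqVneq => [->|]; rewrite ?xA ?andbF.
by rewrite mulr0 big_pred0 // => b; case: eqVneq => [->|]; rewrite ?(negPf xA) ?andbF.
Qed.

(** * Divisor sets, growth of the primes, and the cuboid argument *)

(** With [q = M / p], the gcd of [e * q] and [p * q] is [q], because [e] is coprime to [p].
    Reduction modulo [M] does not affect the gcd. *)
Lemma mem_Div_step (M p e : nat) (A : {set 'Z_M}) (a a' : 'Z_M) :
  (1 < M)%N -> prime p -> (p %| M)%N -> (0 < e < p)%N ->
  a \in A -> a' \in A -> a = a' + (e * (M %/ p))%:R -> (M %/ p)%N \in Div M A.
Proof.
move=> M1 p_pr pM /andP[e0 ltep] aA a'A def_a.
apply/exists_inP; exists a => //; apply/exists_inP; exists a' => //; apply/eqP.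
set q := (M %/ p)%N; have def_M : M = (p * q)%N by rewrite mulnC divnK.
have val_a : nat_of_ord a = ((a' + e * q) %% M)%N.
  by rewrite def_a val_ZpD // val_Zp_nat // modnDmr.
have -> : (nat_of_ord a)%:Z - (nat_of_ord a')%:Z =
    - ((a' + e * q) %/ M)%N%:Z * M%:Z + (e * q)%N%:Z.
  by have := divn_eq (a' + e * q) M; rewrite -val_a; lia.
have -> (k : int) : gcdn `|k|%N M = `|gcdz k M%:Z|%N by [].
rewrite -gcdz_modl modzMDl gcdz_modl /gcdz /= def_M -muln_gcdl.
by rewrite (eqP (_ : coprime e p)) ?mul1n // coprime_sym prime_coprime // gtnNdvd.
Qed.

Lemma pow2_ltn_increasing_primes (d : nat) (p : 'I_d -> nat) :
  (forall i, prime (p i)) ->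
  (forall i j : 'I_d, (i < j)%N -> (p i < p j)%N) ->
  (forall i : 'I_d, (6 <= i.+1)%N -> (2 ^ (i.+1 - 2) < p i)%N) ->
  forall i : 'I_d, (2 ^ i.-1 < p i)%N.
Proof.
move=> p_pr p_incr p_large.
(* All primes after the first are odd, hence the growth by 2. For 0-based [k] from 2 to 4 this
   suffices, as [2 ^ k.-1 <= k.*2]; from 5 on [p_large] takes over. *)
have p_odd k (ltkd : (k < d)%N) : (k.*2 < p (Ordinal ltkd))%N.
  elim: k ltkd => [|k IHk] ltkd; first exact: prime_gt0.
  have := p_incr (Ordinal (ltnW ltkd)) (Ordinal ltkd) (leqnn _).
  have := IHk (ltnW ltkd); have := prime_gt1 (p_pr (Ordinal (ltnW ltkd))).
  have [p2|] := even_prime (p_pr (Ordinal ltkd)); first by rewrite p2; lia.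
  by lia.
case=> k ltkd; have := p_odd k ltkd; have := prime_gt1 (p_pr (Ordinal ltkd)).
case: k ltkd => [|[|[|[|[|k]]]]] ltkd //=.
- by move=> _; apply: leq_trans.
- by move=> _; apply: leq_trans.
- by move=> _ _; have := p_large (Ordinal ltkd) isT; rewrite subn2.
Qed.

(** Common core of both claims: divisibility by ['Phi_M] and a tiling each supply the vanishing at
    all primitive roots. *)
Lemma Div_of_vanishing_sums (d : nat) (p n : 'I_d -> nat) (M : nat)
    (A : {set 'Z_M}) :
  (forall i, prime (p i)) -> (forall i : 'I_d, (2 ^ i.-1 < p i)%N) ->
  (forall i, (0 < n i)%N) -> (1 < M)%N -> M = (\prod_(i < d) p i ^ n i)%N ->
  A != set0 ->
  (forall z : algC, M.-primitive_root z -> \sum_(a in A) z ^+ a = 0) ->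
  exists i : 'I_d, (M %/ p i)%N \in Div M A.
Proof.
move=> p_pr p_large n_gt0 M1 M_def /set0Pn[a aA] zA.
apply/existsP; apply: contraT; rewrite negb_exists => /forallP noDiv.
have p_gt0 i : (0 < p i)%N by exact: prime_gt0.
have pM i : (p i %| M)%N.
  by rewrite M_def (bigD1 i) //= dvdn_mulr // dvdn_exp.
have M0 := ltnW M1.
have noline i b b' e : (0 < e < p i)%N -> b \in A -> b' \in A ->
    b = b' + (e * (M %/ p i))%:R -> False.
  move=> lte bA b'A def_b; case/negP: (noDiv i).
  by apply: (@mem_Div_step M (p i) e A b b') => //.
(* The nonzero multiples of [M / p_i]: there are [p_i - 1] of them, at least [2 ^ i.-1] by
   [p_large]. *)
pose s i := [seq (e * (M %/ p i))%:R : 'Z_M | e <- iota 1 (p i).-1].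
have mem_s i e : e \in iota 1 (p i).-1 -> (0 < e < p i)%N.
  by rewrite mem_iota add1n prednK.
have [||||y ys yA] := @avoiding_cuboid _ _ s (mem A) a.
- move=> i; rewrite map_inj_in_uniq ?iota_uniq // => e e' /mem_s lte /mem_s lte'.
  have ltM k : (0 < k < p i)%N -> (k * (M %/ p i) < M)%N.
    case/andP=> _ ltk; rewrite -[ltnRHS](divnK (pM i)) mulnC ltn_pmul2l //.
    by rewrite divn_gt0 // dvdn_leq.
  move/(congr1 (@nat_of_ord _)); rewrite !val_Zp_nat // !modn_small ?ltM //.
  move/eqP; rewrite eqn_pmul2r; first by move/eqP.
  by rewrite divn_gt0 // dvdn_leq.
- by move=> i; rewrite size_map size_iota -ltnS prednK.
- move=> i _ /mapP[e /mem_s lte ->]; apply/negP => xA.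
  exact: (noline i _ _ e lte xA aA erefl).
- move=> i x _ _ /mapP[e /mem_s lte ->] /mapP[e' /mem_s lte' ->] xA x'A.
  have step k k' : (0 < k' < p i)%N -> (k < k')%N ->
      x + (k * (M %/ p i))%:R \in A -> x + (k' * (M %/ p i))%:R \in A -> False.
    move=> lk' lkk' kA k'A; apply: (noline i _ _ (k' - k)%N _ k'A kA); first by lia.
    by rewrite -addrA -natrD -mulnDl subnKC // ltnW.
  have [ltee'|lte'e|->//] := ltngtP e e'; first by case: (step e e').
  by case: (step e' e).
have [z zP] := C_prim_root_exists M0.
have zAt t : coprime t M -> \sum_(b in A) z ^+ (t * b) = 0.
  move=> tM; have zt : M.-primitive_root (z ^+ t) by rewrite prim_root_exp_coprime.
  by rewrite -[RHS](zA _ zt); apply: eq_bigr => b _; rewrite exprM.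
(* Such a [t] is divisible by some [p_i], and [p_i] annihilates the multiples of [M / p_i]. *)
have yt t : ~~ coprime t M -> exists i, y i *+ t = 0.
  rewrite /coprime => g1.
  have {}g1 : (1 < gcdn t M)%N by rewrite ltn_neqAle eq_sym g1 gcdn_gt0 M0 orbT.
  have r_pr := pdiv_prime g1; set r := pdiv _ in r_pr.
  have /[1!dvdn_gcd]/andP[rt rM] : (r %| gcdn t M)%N by apply: pdiv_dvd.
  have [i /eqP r_pi] : exists i, r == p i.
    apply/existsP; move: rM; rewrite M_def Euclid_dvd_prod // big_has => /hasP[i _].
    rewrite Euclid_dvdX // dvdn_prime2 // => /andP[ri _].
    by apply/existsP; exists i.
  exists i; have /mapP[e _ ->] := ys i; move: rt; rewrite r_pi => /dvdnP[k ->].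
  rewrite -mulrnA -mulnA [(_ * (k * _))%N]mulnCA divnK // mulnA natrM.
  by rewrite pchar_Zp // mulr0.
have := cuboid_sum_eq0 a M1 zP zAt yt.
(* The empty set contributes 1, odd sets 0, and even sets nonnegative terms. *)
rewrite (bigD1 set0) //= cards0 big_set0 addr0 aA mulr1 expr0.
move=> sum0; have : (1 : algC) <= 0.
  rewrite -{}sum0 lerDl sumr_ge0 // => S _.
  have [oS|eS] := boolP (odd #|S|); last first.
    by rewrite -signr_odd (negPf eS) mul1r ler0n.
  by have /negPf/= := yA S oS => yS; rewrite (_ : (_ \in A) = false) ?mulr0.
by rewrite ler10.
Qed.

(** * Cyclotomic divisibility and tilings *)

Lemma mask_polyE (M : nat) (A : {set 'Z_M}) (z : algC) :
  (map_poly intr (mask_poly M A)).[z] = \sum_(a in A) z ^+ a.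
Proof.
rewrite /mask_poly rmorph_sum horner_sum; apply: eq_bigr => a _.
by rewrite rmorphXn /= map_polyX hornerXn.
Qed.

Lemma dvd_Cyclotomic_root (M : nat) (q : {poly int}) (z : algC) :
  'Phi_M %| q -> M.-primitive_root z -> (map_poly intr q).[z] = 0.
Proof.
rewrite Pdiv.IdomainMonic.dvdp_eq ?Cyclotomic_monic // => /eqP-> zP.
rewrite rmorphM hornerM /= (Cintr_Cyclotomic zP).
have /rootP-> : root (cyclotomic z M) z by rewrite root_cyclotomic.
by rewrite mulr0.
Qed.

(** The minimal polynomial of [z] over the rationals is the cyclotomic polynomial, which also
    vanishes at [w]. *)
Lemma root_intr_primitive (M : nat) (q : {poly int}) (z w : algC) :
  M.-primitive_root z -> M.-primitive_root w ->
  (map_poly intr q).[z] = 0 -> (map_poly intr q).[w] = 0.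
Proof.
move=> zP wP /rootP.
have eq_q : map_poly intr q = map_poly ratr (map_poly intr q) :> {poly algC}.
  by rewrite -map_poly_comp; apply: eq_map_poly => c; rewrite /= ratr_int.
have [m [def_m _ min_m]] := minCpolyP z.
rewrite eq_q min_m => /dvdpP[k ->]; apply/rootP.
by rewrite rmorphM rootM /= -def_m (minCpoly_cyclotomic zP) root_cyclotomic // wP orbT.
Qed.

(** By unique representation the product of the two sums is the sum of [z ^+ x] over all of ['Z_M],
    which is 0 since [M > 1]. *)
Lemma tiling_root (M : nat) (A B : {set 'Z_M}) (z : algC) :
  (1 < M)%N -> M.-primitive_root z -> tiling M A B ->
  \sum_(a in A) z ^+ a = 0 \/ \sum_(b in B) z ^+ b = 0.
Proof.
move=> M1 zP tAB.
suff /eqP: (\sum_(a in A) z ^+ a) * (\sum_(b in B) z ^+ b) = 0.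
  by rewrite mulf_eq0 => /orP[]/eqP; [left|right].
transitivity (\sum_(x : 'Z_M) z ^+ x); last first.
  rewrite -(big_mkord xpredT (fun t => z ^+ t)) Zp_cast // big_mkord.
  have := sum_exprZp 1 M1 zP; rewrite expr1 => ->.
  by rewrite -(inj_eq val_inj).
rewrite mulr_suml; under eq_bigr do rewrite mulr_sumr.
rewrite pair_big /= (partition_big (fun ab => ab.1 + ab.2) xpredT) //=.
apply: eq_bigr => x _; have [[a b] [[/= aA bB abx] uniq_ab]] := tAB x.
rewrite (big_pred1 (a, b)) /= => [|[a' b']] /=.
  by rewrite -exprZpD // abx.
apply/idP/eqP => [/andP[/andP[a'A b'B] /eqP abx']|[-> ->]].
  by rewrite -(uniq_ab (a', b')).
by rewrite aA bB abx eqxx.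
Qed.

Lemma tiling_neq0 (M : nat) (A B : {set 'Z_M}) :
  tiling M A B -> A != set0 /\ B != set0.
Proof.
by case/(_ 0) => [[a b] [[/= aA bB _] _]]; split; apply/set0Pn; [exists a|exists b].
Qed.

Theorem theorem1p3 (d : nat) (p n : 'I_d -> nat) (M : nat)
    (d_gt0 : (0 < d)%N)
    (p_prime : forall i : 'I_d, prime (p i))
    (p_incr : forall i j : 'I_d, (i < j)%N -> (p i < p j)%N)
    (n_gt0 : forall i : 'I_d, (0 < n i)%N)
    (* i : 'I_d stands for the 1-based index j = i.+1 *)
    (p_large : forall i : 'I_d, (6 <= i.+1)%N -> (2 ^ (i.+1 - 2) < p i)%N)
    (M_def : M = (\prod_(i < d) p i ^ n i)%N) :
  (forall A : {set 'Z_M},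
      A != set0 -> 'Phi_M %| mask_poly M A ->
      exists i : 'I_d, (M %/ p i)%N \in Div M A)
  /\
  (forall A B : {set 'Z_M},
      tiling M A B ->
      exists i : 'I_d, (M %/ p i)%N \in [predU Div M A & Div M B]).
Proof.
have p_gt i := pow2_ltn_increasing_primes p_prime p_incr p_large i.
have M1 : (1 < M)%N.
  have M0 : (0 < M)%N.
    by rewrite M_def prodn_gt0 // => i; rewrite expn_gt0 prime_gt0.
  apply: leq_trans (prime_gt1 (p_prime (Ordinal d_gt0))) (dvdn_leq M0 _).
  by rewrite M_def (bigD1 (Ordinal d_gt0)) //= dvdn_mulr // dvdn_exp.
have conclude (A : {set 'Z_M}) (A0 : A != set0) :=
  Div_of_vanishing_sums p_prime p_gt n_gt0 M1 M_def A0.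
have [z zP] := C_prim_root_exists (ltnW M1).
split=> [A A0 PhiA|A B tAB].
  by apply: conclude => // w wP; rewrite -mask_polyE (dvd_Cyclotomic_root PhiA wP).
have [A0 B0] := tiling_neq0 tAB.
have transfer (C : {set 'Z_M}) (w : algC) : \sum_(c in C) z ^+ c = 0 ->
    M.-primitive_root w -> \sum_(c in C) w ^+ c = 0.
  by rewrite -!mask_polyE => zC wP; apply: root_intr_primitive zP wP zC.
have [zA|zB] := tiling_root M1 zP tAB.
  have [i iA] := conclude A A0 (fun w => transfer A w zA).
  by exists i; rewrite inE /= iA.
have [i iB] := conclude B B0 (fun w => transfer B w zB).
by exists i; rewrite inE /= iB orbT.
Qed.
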